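(* Let $A=[a_{rs}]$ be a strictly upper triangular binary $n\times n$ matrix with exactly two non-zero rows, those with indices $i<j$, such that the real Bott manifold $M(A)$ is orientable. Let $k,m\ge 0$, $l\ge 1$ and $i_1\ge 0$ be integers with $i_1+2k+2l+2m\le n$. 1. Suppose that $a_{i,r}=1$ exactly for $r\in\{i_1+1,\dots,i_1+2k+2l\}$ and $a_{j,s}=1$ exactly for $s\in\{i_1+2k+1,\dots,i_1+2k+2l+2m\}$. Then $M(A)$ has a Spin-structure if and only if either $l$ and $m$ have the same parity, or $l$ and $m$ have different parity and $j\notin\{i_1+1,\dots,i_1+2k\}$. 2. Suppose that $a_{j,r}=1$ exactly for $r\in\{i_1+1,\dots,i_1+2k+2l\}$ and $a_{i,s}=1$ exactly for $s\in\{i_1+2k+1,\dots,i_1+2k+2l+2m\}$. Then $M(A)$ has a Spin-structure.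
   Context: For a strictly upper triangular $n\times n$ matrix $A=[a_{ij}]$ with entries in $\{0,1\}$, the real Bott manifold $M(A)$ is the flat manifold $\mathbb{R}^n/\Gamma(A)$, where $\Gamma(A)\subset \operatorname{Isom}(\mathbb{R}^n)=O(n)\ltimes\mathbb{R}^n$ is the group generated by $s_1,\dots,s_n$, with $s_i=(\operatorname{diag}((-1)^{a_{i1}},\dots,(-1)^{a_{in}}),\ \tfrac12 e_i)$ and $e_i$ the $i$-th standard basis vector. $M(A)$ is orientable if and only if the sum of the entries in each row of $A$ is even. An oriented flat manifold $\mathbb{R}^n/\Gamma$, with $\Gamma\subset SO(n)\ltimes\mathbb{R}^n$ its fundamental group and $p$ the projection to $SO(n)$, has a Spin-structure if and only if there is a homomorphism $\epsilon:\Gamma\to\operatorname{Spin}(n)$ with $\lambda_n\epsilon=p$, where $\lambda_n:\operatorname{Spin}(n)\to SO(n)$ is the covering map; equivalently, its second Stiefel–Whitney class $w_2$ vanishes. In an interval $\{a,\dots,b\}$ of integers, the set is empty if $b<a$. *)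

(* Defs.v *)
From HB Require Import structures.
From mathcomp Require Import all_boot all_order all_algebra.
From mathcomp Require Import reals ring.

Set Implicit Arguments.
Unset Strict Implicit.
Unset Printing Implicit Defensive.

Import Order.TTheory GRing.Theory Num.Theory.
Local Open Scope ring_scope.

(* The Clifford algebra with e_i ^ 2 = -1 and e_i e_j = - e_j e_i, as the free
   module on the blades e_S = e_{s_1} ... e_{s_p}, S = {s_1 < ... < s_p}.
   Sorting the word e_S e_T costs one sign for each pair t < s (transposition)
   and one for each pair t = s (square), and leaves e_(S symdiff T). *)
Definition symdiff (n : nat) (S T : {set 'I_n}) : {set 'I_n} :=
  (S :\: T) :|: (T :\: S).

Definition blade_sign (R : comNzRingType) (n : nat) (S T : {set 'I_n}) : R :=
  (-1) ^+ (\sum_(s in S) \sum_(t in T) (t <= s)%N).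

Definition clifford (R : comNzRingType) (n : nat) : Type :=
  {ffun {set 'I_n} -> R^o}.

HB.instance Definition _ (R : comNzRingType) (n : nat) :=
  GRing.Lmodule.copy (clifford R n) {ffun {set 'I_n} -> R^o}.

Section CliffordRing.

Variables (R : comNzRingType) (n : nat).
Implicit Types (S T U : {set 'I_n}) (x y z : clifford R n).

Local Notation sg := (@blade_sign R n).

Definition blade S : clifford R n := [ffun T => (T == S)%:R].

Definition cliff_mul x y : clifford R n :=
  [ffun T => \sum_(S : {set 'I_n}) sg S (symdiff S T) * x S * y (symdiff S T)].

Lemma in_symdiff S T i : (i \in symdiff S T) = (i \in S) (+) (i \in T).
Proof. by rewrite !inE; case: (i \in S); case: (i \in T). Qed.

Lemma symdiffA : associative (@symdiff n).
Proof. by move=> S T U; apply/setP => i; rewrite !in_symdiff addbA. Qed.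

Lemma symdiffC : commutative (@symdiff n).
Proof. by move=> S T; apply/setP => i; rewrite !in_symdiff addbC. Qed.

Lemma symdiff0 S : symdiff S set0 = S.
Proof. by apply/setP => i; rewrite in_symdiff inE addbF. Qed.

Lemma symdiff_self S : symdiff S S = set0.
Proof. by apply/setP => i; rewrite in_symdiff inE addbb. Qed.

Lemma symdiffK S : involutive (symdiff S).
Proof. by move=> T; rewrite symdiffA symdiff_self symdiffC symdiff0. Qed.

Lemma blade_signE S T :
  sg S T = \prod_(s in S) \prod_(t in T) (-1) ^+ (t <= s)%N.
Proof.
by rewrite /blade_sign -prodrXr; apply: eq_bigr => s _; rewrite prodrXr.
Qed.

Lemma blade_sign_sqr S T : sg S T * sg S T = 1.
Proof. by rewrite /blade_sign -expr2 sqrr_sign. Qed.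

Lemma prod_symdiff (f : 'I_n -> R) S T : (forall i, f i * f i = 1) ->
  \prod_(i in symdiff S T) f i = \prod_(i in S) f i * \prod_(i in T) f i.
Proof.
move=> f2; rewrite [LHS]big_mkcond [X in X * _]big_mkcond [X in _ * X]big_mkcond.
rewrite -big_split /=; apply: eq_bigr => i _; rewrite in_symdiff.
by case: (i \in S); case: (i \in T); rewrite /= ?f2 ?mulr1 ?mul1r.
Qed.

Lemma blade_signDl S T U : sg (symdiff S T) U = sg S U * sg T U.
Proof.
rewrite !blade_signE prod_symdiff// => i.
by rewrite -big_split big1//= => t _; rewrite -expr2 sqrr_sign.
Qed.

Lemma blade_signDr S T U : sg S (symdiff T U) = sg S T * sg S U.
Proof.
rewrite !blade_signE -big_split; apply: eq_bigr => s _ /=.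
by rewrite prod_symdiff// => i; rewrite -expr2 sqrr_sign.
Qed.

Lemma blade_sign0l S : sg set0 S = 1.
Proof. by rewrite blade_signE big_set0. Qed.

Lemma blade_sign0r S : sg S set0 = 1.
Proof. by rewrite blade_signE big1// => s _; rewrite big_set0. Qed.

Lemma cliff_mulA : associative cliff_mul.
Proof.
move=> x y z; apply/ffunP => D; rewrite !ffunE.
under eq_bigr do rewrite ffunE mulr_sumr.
under [RHS]eq_bigr do rewrite ffunE mulr_sumr mulr_suml.
rewrite [RHS]exchange_big /=; apply: eq_bigr => S _.
rewrite [RHS](reindex_inj (can_inj (symdiffK S))) /=; apply: eq_bigr => T _.
rewrite symdiffK.
have -> : symdiff (symdiff S T) D = symdiff T (symdiff S D).
  by rewrite (symdiffC S T) symdiffA.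
rewrite [in RHS]blade_signDl [sg S (symdiff T _)]blade_signDr.
have := blade_sign_sqr S T.
move: (sg S _) (sg T _) (sg S T) => a b c c2.
transitivity (c * c * (a * x S * (b * y T * z (symdiff T (symdiff S D))))).
  by rewrite c2 mul1r.
by move: (x S : R) (y T : R) (z _ : R) => u v w; ring.
Qed.

Lemma cliff_mul1l : left_id (blade set0) cliff_mul.
Proof.
move=> x; apply/ffunP => T; rewrite ffunE (bigD1 set0)//= big1 ?addr0.
  by rewrite ffunE eqxx blade_sign0l !mul1r symdiffC symdiff0.
by move=> S /negPf S0; rewrite ffunE S0 mulr0 mul0r.
Qed.

Lemma cliff_mul1r : right_id (blade set0) cliff_mul.
Proof.
move=> x; apply/ffunP => T; rewrite ffunE (bigD1 T)//= big1 ?addr0.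
  by rewrite ffunE symdiff_self eqxx blade_sign0r mul1r mulr1.
move=> S /negPf ST; rewrite ffunE; case: eqP => [e|]; last by rewrite mulr0.
by rewrite -(symdiffK S T) e symdiff0 eqxx in ST.
Qed.

Lemma cliff_mulDl : left_distributive cliff_mul +%R.
Proof.
move=> x y z; apply/ffunP => T; rewrite !ffunE -big_split /=.
by apply: eq_bigr => S _; rewrite ffunE mulrDr mulrDl.
Qed.

Lemma cliff_mulDr : right_distributive cliff_mul +%R.
Proof.
move=> x y z; apply/ffunP => T; rewrite !ffunE -big_split /=.
by apply: eq_bigr => S _; rewrite ffunE mulrDr.
Qed.

Lemma cliff_one_neq0 : blade set0 != 0.
Proof.
by apply/eqP => /ffunP /(_ set0) /eqP; rewrite !ffunE eqxx oner_eq0.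
Qed.

HB.instance Definition _ := GRing.Zmodule_isNzRing.Build (clifford R n)
  cliff_mulA cliff_mul1l cliff_mul1r cliff_mulDl cliff_mulDr cliff_one_neq0.

Lemma cliff_scaleAl (a : R) x y : a *: (x * y) = (a *: x) * y.
Proof.
apply/ffunP => T; rewrite !ffunE scaler_sumr.
by apply: eq_bigr => S _; rewrite ffunE /GRing.scale /= !mulrA (mulrC a).
Qed.

HB.instance Definition _ :=
  GRing.Lmodule_isLalgebra.Build R (clifford R n) cliff_scaleAl.

Lemma cliff_scaleAr (a : R) x y : a *: (x * y) = x * (a *: y).
Proof.
apply/ffunP => T; rewrite !ffunE scaler_sumr.
by apply: eq_bigr => S _; rewrite ffunE /GRing.scale /= mulrCA.
Qed.

HB.instance Definition _ :=
  GRing.Lalgebra_isAlgebra.Build R (clifford R n) cliff_scaleAr.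


Lemma blade_mul S T :
  blade S * blade T = sg S T *: blade (symdiff S T).
Proof.
apply/ffunP => U; rewrite !ffunE (bigD1 S)//= big1 ?addr0 => [|V /negPf VS].
  rewrite !ffunE eqxx mulr1 /GRing.scale /=.
  have [->|UST] := eqVneq U (symdiff S T); first by rewrite symdiffK eqxx !mulr1.
  case: eqP => [e|]; last by rewrite !mulr0.
  by rewrite -e symdiffK eqxx in UST.
by rewrite ffunE VS mulr0 mul0r.
Qed.

(* The anti-automorphism with e_i |-> - e_i. It multiplies e_S, |S| = p, by
   (-1) ^ p for the generators and (-1) ^ (p (p - 1) / 2) for the reversal;
   p (p + 1) / 2 is the exponent in blade_sign S S. *)
Definition cliff_conj x : clifford R n := [ffun S => sg S S * x S].

Lemma cliff_conjM x y : cliff_conj (x * y) = cliff_conj y * cliff_conj x.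
Proof.
apply/ffunP => U; rewrite !ffunE mulr_sumr.
rewrite (reindex_inj (can_inj (fun S : {set 'I_n} => symdiffK U S))) /=.
apply: eq_bigr => S _; rewrite !ffunE.
have -> : symdiff (symdiff U S) U = S.
  by rewrite symdiffC symdiffK.
have [T ->] : exists T, U = symdiff S T.
  by exists (symdiff S U); rewrite symdiffK.
rewrite (symdiffC _ S) !symdiffK.
rewrite blade_signDl !blade_signDr.
have := blade_sign_sqr T S.
move: (sg S S) (sg T T) (sg S T) (sg T S) (x T : R) (y S : R).
move=> a b c d u v d2.
transitivity (d * d * (c * (a * v) * (b * u))); last by rewrite d2 mul1r.
by ring.
Qed.

Definition cliff_vec (v : 'cV[R]_n) : clifford R n :=
  \sum_i v i 0 *: blade [set i].

Lemma cliff_vecE v i : cliff_vec v [set i] = v i 0.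
Proof.
rewrite sum_ffunE (bigD1 i)//= big1 => [|j /negPf ji].
  by rewrite !ffunE eqxx addr0 /GRing.scale /= mulr1.
by rewrite !ffunE (inj_eq set1_inj) eq_sym ji scaler0.
Qed.

Lemma cliff_conj_vec v : cliff_conj (cliff_vec v) = - cliff_vec v.
Proof.
apply/ffunP => S; rewrite !ffunE sum_ffunE mulr_sumr -sumrN.
apply: eq_bigr => i _; rewrite !ffunE.
have [->|_] := eqVneq S [set i]; last by rewrite !scaler0 mulr0 oppr0.
by rewrite /blade_sign !big_set1 leqnn mulN1r.
Qed.

Lemma blade1_anticomm (i j : 'I_n) :
  blade [set i] * blade [set j] + blade [set j] * blade [set i]
  = - ((i == j)%:R *+ 2).
Proof.
have sg1 k l : sg [set k] [set l] = (-1) ^+ (l <= k)%N.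
  by rewrite /blade_sign !big_set1.
rewrite !blade_mul !sg1 (symdiffC [set j]) -scalerDl.
have [->|ij] := eqVneq i j.
  by rewrite leqnn symdiff_self -opprD scaleNr scalerDl scale1r.
have -> : (-1) ^+ (j <= i)%N + (-1) ^+ (i <= j)%N = 0 :> R.
  by case: ltngtP ij => [||/val_inj->]; rewrite ?eqxx// => _ _;
     rewrite ?addNr ?addrN.
by rewrite scale0r mul0rn oppr0.
Qed.

(* Polarized form of v ^ 2 = - |v| ^ 2. *)
Lemma cliff_vec_anticomm u v :
  cliff_vec u * cliff_vec v + cliff_vec v * cliff_vec u
  = - ((u^T *m v) 0 0 *+ 2)%:A.
Proof.
rewrite {1 4}/cliff_vec mulr_suml mulr_sumr -big_split /= mxE.
rewrite -sumrMnl scaler_suml -sumrN; apply: eq_bigr => i _.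
rewrite /cliff_vec mulr_suml mulr_sumr -big_split /= (bigD1 i)//=.
rewrite big1 ?addr0 => [|j /negPf ji]; rewrite -!scalerAl -!scalerAr.
  rewrite mxE [_ *: (_ *: (blade _ * blade [set i]))]scalerA mulrC -scalerA.
  rewrite -!scalerDr blade1_anticomm eqxx scalerN scalerN scalerA.
  by rewrite -scalerMnr scalerMnl.
rewrite [u i 0 *: _]scalerA mulrC -scalerA -!scalerDr blade1_anticomm.
by rewrite eq_sym ji mul0rn oppr0 !scaler0.
Qed.

End CliffordRing.

Section Spin.

Variables (R : realType) (n : nat).

Definition spin (x : clifford R n) : Prop :=
  exists s : seq 'cV[R]_n,
    [/\ ~~ odd (size s), {in s, forall v, v^T *m v = 1%:M}
      & x = \prod_(v <- s) cliff_vec v].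

(* The matrix of v |-> x v (conj x). For x in Spin(n), x v (conj x) is again a
   vector (spin_coverP) and conj x is the inverse of x (spin_conjV). *)
Definition spin_cover (x : clifford R n) : 'M[R]_n :=
  \matrix_(i, j) (x * blade R [set j] * cliff_conj x) [set i].

Lemma cliff_vec_is_linear : linear (@cliff_vec R n).
Proof.
move=> a u v; rewrite /cliff_vec scaler_sumr -big_split /=.
by apply: eq_bigr => i _; rewrite !mxE scalerDl scalerA.
Qed.

HB.instance Definition _ :=
  GRing.isLinear.Build R 'cV[R]_n (clifford R n) *:%R (@cliff_vec R n)
    cliff_vec_is_linear.

Lemma cliff_vec_delta (j : 'I_n) : cliff_vec (delta_mx j 0) = blade R [set j].
Proof.
rewrite /cliff_vec (bigD1 j)//= big1 => [|i /negPf ij].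
  by rewrite mxE !eqxx scale1r addr0.
by rewrite mxE ij scale0r.
Qed.

Lemma unit_vec_sqr (u : 'cV[R]_n) : u^T *m u = 1%:M ->
  cliff_vec u * cliff_vec u = -1.
Proof.
move=> u1; have := cliff_vec_anticomm u u.
rewrite u1 mxE eqxx -mulr2n -scalerMnl scale1r -mulNrn => /eqP.
rewrite -subr_eq0 -mulrnBl -scaler_nat scaler_eq0 pnatr_eq0 /= subr_eq0.
by move=> /eqP.
Qed.

Lemma unit_vec_conj (u w : 'cV[R]_n) : u^T *m u = 1%:M ->
  cliff_vec u * cliff_vec w * cliff_conj (cliff_vec u) =
  cliff_vec (((u^T *m w) 0 0 *+ 2) *: u - w).
Proof.
move=> u1; rewrite cliff_conj_vec linearB linearZ /=.
have -> : cliff_vec u * cliff_vec w =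
    - ((u^T *m w) 0 0 *+ 2)%:A - cliff_vec w * cliff_vec u.
  by rewrite -cliff_vec_anticomm addrK.
rewrite -opprD mulrNN mulrDl -mulrA unit_vec_sqr// mulrN1.
by rewrite -scalerAl mul1r.
Qed.

Lemma spin_coverP x (v : 'cV[R]_n) : spin x ->
  x * cliff_vec v * cliff_conj x = cliff_vec (spin_cover x *m v).
Proof.
case=> s [_ s1 xE].
suff [M xM] : exists M : 'M[R]_n, forall w : 'cV[R]_n,
    x * cliff_vec w * cliff_conj x = cliff_vec (M *m w).
  have -> : spin_cover x = M; last exact: xM.
  apply/matrixP => i j; rewrite mxE -cliff_vec_delta xM cliff_vecE.
  by rewrite -colE mxE.
rewrite {}xE; elim: s s1 => [_|u s IHs us1].
  exists 1%:M => w; rewrite big_nil mul1r mul1mx.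
  have -> : cliff_conj 1 = 1 :> clifford R n; last by rewrite mulr1.
  apply/ffunP => S; rewrite !ffunE.
  by case: eqP => [->|]; rewrite ?blade_sign0l ?mulr1 ?mulr0.
have u1 : u^T *m u = 1%:M by apply: us1; rewrite mem_head.
have {IHs} [|M sM] := IHs.
  by move=> w ws; apply: us1; rewrite inE ws orbT.
exists ((u *m u^T *+ 2 - 1%:M) *m M) => w; rewrite big_cons cliff_conjM.
set y := \prod_(_ <- _) _ in sM *.
rewrite -!mulrA (mulrA y) (mulrA (y * _)) sM mulrA unit_vec_conj//.
congr cliff_vec; rewrite -mulmxA mulmxBl mul1mx.
rewrite -scaler_nat -scalemxAl -mulmxA [u^T *m _ in RHS]mx11_scalar.
by rewrite mul_mx_scalar scalerA mulr_natl.
Qed.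

Lemma spin_conjV x : spin x -> x * cliff_conj x = 1.
Proof.
case=> s [ev s1 ->].
suff -> : \prod_(v <- s) cliff_vec v * cliff_conj (\prod_(v <- s) cliff_vec v)
    = 1 :> clifford R n by [].
elim: s s1 {ev} => [_|u s IHs us1].
  rewrite big_nil mul1r; apply/ffunP => S; rewrite !ffunE.
  by case: eqP => [->|]; rewrite ?blade_sign0l ?mulr1 ?mulr0.
have u1 : u^T *m u = 1%:M by apply: us1; rewrite mem_head.
rewrite big_cons cliff_conjM -mulrA (mulrA (\prod_(_ <- _) _)) IHs.
  by rewrite mul1r cliff_conj_vec mulrN unit_vec_sqr// opprK.
by move=> w ws; apply: us1; rewrite inE ws orbT.
Qed.

End Spin.

Section Isometry.

Variables (R : realType) (n : nat).

(* Isom(R^n) = O(n) |x R^n; (B, b) is the map v |-> B v + b. *)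
Record isometry : Type := Isometry {
  lin_part : 'M[R]_n;
  trans_part : 'cV[R]_n;
  isometry_orthogonal : lin_part *m lin_part^T == 1%:M }.

Definition isometry_pair (g : isometry) := (lin_part g, trans_part g).

Definition pair_isometry (p : 'M[R]_n * 'cV[R]_n) : option isometry :=
  if p.1 *m p.1^T == 1%:M =P true is ReflectT h then Some (Isometry p.2 h)
  else None.

Lemma isometry_pairK : pcancel isometry_pair pair_isometry.
Proof.
case=> B b BO; rewrite /pair_isometry /=; case: eqP => [h|/(_ BO)//].
by rewrite (bool_irrelevance h BO).
Qed.

HB.instance Definition _ := Choice.copy isometry (pcan_type isometry_pairK).

Lemma isometry_eq (g h : isometry) :
  lin_part g = lin_part h -> trans_part g = trans_part h -> g = h.
Proof.
move=> e1 e2; apply: (pcan_inj isometry_pairK).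
by rewrite /isometry_pair e1 e2.
Qed.

Fact isometry_one_subproof : (1%:M : 'M[R]_n) *m 1%:M^T == 1%:M.
Proof. by rewrite trmx1 mulmx1. Qed.

Definition isometry_one := Isometry 0 isometry_one_subproof.

Fact isometry_mul_subproof (g h : isometry) :
  (lin_part g *m lin_part h) *m (lin_part g *m lin_part h)^T == 1%:M.
Proof.
rewrite trmx_mul -mulmxA (mulmxA (lin_part h)).
by rewrite (eqP (isometry_orthogonal h)) mul1mx isometry_orthogonal.
Qed.

Definition isometry_mul (g h : isometry) := Isometry
  (lin_part g *m trans_part h + trans_part g) (isometry_mul_subproof g h).

Fact isometry_inv_subproof (g : isometry) :
  (lin_part g)^T *m (lin_part g)^T^T == 1%:M.
Proof. by rewrite trmxK (mulmx1C (eqP (isometry_orthogonal g))). Qed.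

Definition isometry_inv (g : isometry) := Isometry
  (- ((lin_part g)^T *m trans_part g)) (isometry_inv_subproof g).

Lemma isometry_mulA : associative isometry_mul.
Proof.
by move=> f g h; apply: isometry_eq; rewrite /= ?mulmxDr !mulmxA ?addrA.
Qed.

Lemma isometry_mul1g : left_id isometry_one isometry_mul.
Proof. by move=> g; apply: isometry_eq; rewrite /= mul1mx ?addr0. Qed.

Lemma isometry_mulg1 : right_id isometry_one isometry_mul.
Proof.
by move=> g; apply: isometry_eq; rewrite /= ?mulmx1 ?mulmx0 ?add0r.
Qed.

Lemma isometry_mulVg : left_inverse isometry_one isometry_inv isometry_mul.
Proof.
move=> g; apply: isometry_eq; rewrite /= ?addrN//.
by rewrite (mulmx1C (eqP (isometry_orthogonal g))).
Qed.

Lemma isometry_mulgV : right_inverse isometry_one isometry_inv isometry_mul.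
Proof.
move=> g; apply: isometry_eq; rewrite /= ?(eqP (isometry_orthogonal g))//.
by rewrite mulmxN mulmxA (eqP (isometry_orthogonal g)) mul1mx addNr.
Qed.

HB.instance Definition _ := isGroup.Build isometry
  isometry_mulA isometry_mul1g isometry_mulg1 isometry_mulVg isometry_mulgV.

End Isometry.

(* The subgroup generated by the range of s. *)
Inductive generated (G : groupType) (I : Type) (s : I -> G) : G -> Prop :=
| generated_gen i : generated s (s i)
| generated_one : generated s 1%g
| generated_mul g h :
    generated s g -> generated s h -> generated s (g * h)%g
| generated_inv g : generated s g -> generated s g^-1%g.

Section FlatManifold.

Variables (R : realType) (n : nat).

(* These two predicates concern the flat manifold R^n / G, given by its
   fundamental group G < Isom(R^n). *)
Definition flat_orientable (G : isometry R n -> Prop) : Prop :=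
  forall g, G g -> \det (lin_part g) = 1.

Definition has_spin_structure (G : isometry R n -> Prop) : Prop :=
  exists eps : isometry R n -> clifford R n,
    [/\ forall g, G g -> spin (eps g),
        forall g h, G g -> G h -> eps (g * h)%g = eps g * eps h
      & forall g, G g -> spin_cover (eps g) = lin_part g].

End FlatManifold.

Section RealBott.

Variables (R : realType) (n : nat).

Definition strictly_upper_triangular (A : 'M[bool]_n) : Prop :=
  forall r s : 'I_n, (s <= r)%N -> A r s = false.

Definition bott_lin (A : 'M[bool]_n) (i : 'I_n) : 'M[R]_n :=
  diag_mx (\row_j (-1) ^+ A i j).

Fact bott_lin_orthogonal A i : bott_lin A i *m (bott_lin A i)^T == 1%:M.
Proof.
rewrite tr_diag_mx mulmx_diag -diag_const_mx; apply/eqP; congr diag_mx.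
by apply/rowP => j; rewrite !mxE -expr2 sqrr_sign.
Qed.

Definition bott_gen (A : 'M[bool]_n) (i : 'I_n) : isometry R n :=
  Isometry (2^-1 *: delta_mx i 0) (bott_lin_orthogonal A i).

Definition bott_group (A : 'M[bool]_n) : isometry R n -> Prop :=
  generated (bott_gen A).

End RealBott.

Arguments bott_group R {n} A _.

(* 'I_n is 0-based: r : 'I_n stands for the index r.+1 of {1, ..., n}. *)
Definition index_in (n a b : nat) (r : 'I_n) : bool := (a <= r.+1 <= b)%N.

(* Main.v *)
(** In [Gamma(A)] one has [s_i s_j s_i^-1 = s_j^{(-1)^(a_ij)}], and a lift of the
    linear part of [s_r] to [Spin(n)] is [e_S] up to sign, where [S] is the support
    of the row [r]. For rows of even size with even intersection, [e_{S_i}] and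
    [e_{S_j}] commute, so lifts can be chosen consistently unless [a_ij = 1], in
    which case they exist exactly when [e_{S_j}^2 = (-1)^(|S_j| / 2)] is [1].
    As [A] is strictly upper triangular, [a_ij = 1] forces [i_1 + 1 <= j <= i_1 + 2k]
    in the first case, where [|S_j| / 2 = l + m], and is impossible in the second. *)

Require Import Defs.
From mathcomp Require Import all_boot all_order all_algebra.
From mathcomp Require Import reals.
From mathcomp Require Import ring zify.

Import Order.TTheory GRing.Theory Num.Theory.

Set Implicit Arguments.
Unset Strict Implicit.
Unset Printing Implicit Defensive.

(** * Signs and products of blades in the Clifford algebra *)

Section Blades.

Local Open Scope ring_scope.

Variables (R : comNzRingType) (n : nat).
Implicit Types (S T U : {set 'I_n}) (x y z : clifford R n).

Local Notation blade := (@blade R n).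
Local Notation sg := (@blade_sign R n).

(** A pair with [s != t] satisfies exactly one of [t <= s] and [s <= t], a pair with [s = t]
    satisfies both: one unit per pair, and one more per common element. *)
Lemma sum_leq_swap S T :
  (\sum_(s in S) \sum_(t in T) (t <= s)%N
   + \sum_(t in T) \sum_(s in S) (s <= t)%N = #|S| * #|T| + #|S :&: T|)%N.
Proof.
rewrite [X in (_ + X)%N]exchange_big -big_split /=.
have -> : (#|S| * #|T| + #|S :&: T| = \sum_(s in S) (#|T| + (s \in T)))%N.
  rewrite big_split /= sum_nat_const; congr addn.
  rewrite -sum1_card big_mkcond /= [RHS]big_mkcond /=.
  by apply: eq_bigr => s _; rewrite inE; case: (s \in S); case: (s \in T).
apply: eq_bigr => s _; rewrite -big_split /=.
have -> : (\sum_(t in T) ((t <= s) + (s <= t)) = \sum_(t in T) (1 + (t == s)))%N.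
  by apply: eq_bigr => t _; rewrite -val_eqE /=; case: ltngtP.
rewrite big_split /= sum1_card; congr addn.
rewrite (eq_bigr (fun t => if t == s then 1 else 0)%N) => [|t _]; last by case: eqP.
rewrite -big_mkcondr /=; have [sT|sT] := boolP (s \in T).
  by rewrite (big_pred1 s) // => t /=; case: eqP => [->|_]; rewrite ?sT ?andbF.
by rewrite big_pred0 // => t; case: eqP => [->|_]; rewrite ?(negPf sT) ?andbF.
Qed.

Lemma blade_sign_swap S T :
  sg S T * sg T S = (-1) ^+ (#|S| * #|T| + #|S :&: T|).
Proof. by rewrite /blade_sign -exprD sum_leq_swap. Qed.

Lemma blade_mulC S T : ~~ odd (#|S| * #|T| + #|S :&: T|) ->
  blade S * blade T = blade T * blade S.
Proof.
move=> ev; rewrite !blade_mul (symdiffC T); congr (_ *: _).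
have := blade_sign_swap S T; rewrite -signr_odd (negPf ev) expr0 => e.
by rewrite -[RHS]mul1r -(blade_sign_sqr R S T) -mulrA e mulr1.
Qed.

(** For [S = T] the two sums of [sum_leq_swap] coincide, so the exponent is [2p^2 + p], which has
    the parity of [p]. *)
Lemma blade_sign_diag p S : #|S| = (2 * p)%N -> sg S S = (-1) ^+ p.
Proof.
move=> Sp; rewrite /blade_sign; have := sum_leq_swap S S; rewrite setIid Sp.
set e := (\sum_(s in S) _)%N => ee.
have -> : e = (p + (p * p).*2)%N by lia.
by rewrite exprD -[X in _ * X]signr_odd odd_double mulr1.
Qed.

Lemma blade_sqr S : blade S * blade S = (sg S S)%:A.
Proof. by rewrite blade_mul symdiff_self. Qed.

Lemma blade_exp4 S : blade S ^+ 4 = 1.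
Proof.
rewrite (exprM _ 2 2) [blade S ^+ 2]expr2 blade_sqr expr2 -scalerAl mul1r scalerA.
by rewrite blade_sign_sqr scale1r.
Qed.

(** Multiplication by a blade permutes the coordinates up to sign. Together with its left-handed
    counterpart, this turns commutation with a generator into equations between coefficients. *)
Lemma mul_blade_coef x T U : (x * blade T) (symdiff U T) = sg U T * x U.
Proof.
rewrite ffunE (bigD1 U)//= big1 => [|V VU]; rewrite ffunE.
  by rewrite symdiffK eqxx mulr1 addr0.
case: eqP => [e|]; last by rewrite mulr0.
case/eqP: VU; apply: (can_inj (symdiffK T)).
by rewrite ![symdiff T _]symdiffC -[in LHS]e symdiffK.
Qed.

Lemma blade_mul_coef x T U : (blade T * x) (symdiff T U) = sg T U * x U.
Proof.
rewrite ffunE (bigD1 T)//= big1 => [|V /negPf VT]; rewrite ffunE.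
  by rewrite eqxx mulr1 addr0 symdiffK.
by rewrite VT mulr0 mul0r.
Qed.

Lemma cliff_conj_blade S : cliff_conj (blade S) = sg S S *: blade S.
Proof.
apply/ffunP => T; rewrite !ffunE.
by case: eqP => [->//|_]; rewrite mulr0 scaler0.
Qed.

(** Moving [e_t] past [e_S] costs the sign of [blade_sign_swap], and [cliff_conj] of a blade is its
    inverse. For [#|S|] even, conjugation thus negates exactly the coordinates in [S]. *)
Lemma blade_conj_vec S (t : 'I_n) :
  blade S * blade [set t] * cliff_conj (blade S)
  = (-1) ^+ (#|S| + (t \in S)) *: blade [set t].
Proof.
have -> : blade S * blade [set t]
    = (-1) ^+ (#|S| + (t \in S)) *: (blade [set t] * blade S).
  rewrite !blade_mul symdiffC scalerA.
  congr (_ *: _); have -> : (#|S| + (t \in S) = #|S| * #|[set t]| + #|S :&: [set t]|)%N.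
    rewrite cards1 muln1; congr addn; have [tS|tS] := boolP (t \in S).
      by move: tS; rewrite -sub1set => /setIidPr->; rewrite cards1.
    apply/esym/eqP; rewrite cards_eq0 -subset0; apply/subsetP => x.
    by rewrite !inE => /andP[xS /eqP xt]; rewrite -xt xS in tS.
  by rewrite -blade_sign_swap -mulrA blade_sign_sqr mulr1.
rewrite cliff_conj_blade -!scalerAl -scalerAr -mulrA blade_sqr -scalerAr mulr1.
by rewrite [sg S S *: _]scalerA blade_sign_sqr scale1r.
Qed.

Lemma prod_blade1 (s : seq 'I_n) : uniq s -> exists e : nat,
  \prod_(t <- s) blade [set t] = (-1) ^+ e *: blade [set t in s].
Proof.
elim: s => [_|t s IHs /= /andP[ts /IHs[e es]]].
  exists 0%N; rewrite big_nil scale1r; apply: (congr1 blade).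
  by apply/setP => x; rewrite !inE.
rewrite big_cons es -scalerAr blade_mul scalerA.
have -> : symdiff [set t] [set x in s] = [set x in t :: s].
  apply/setP => x; rewrite in_symdiff !inE.
  by case: eqP => [->|_]; rewrite ?(negPf ts).
by rewrite /blade_sign -exprD; eexists.
Qed.

End Blades.

(** * The Spin group, the kernel of its covering map, and lifts of diagonal matrices *)

Section SpinGroup.

Local Open Scope ring_scope.

Variables (R : realType) (n : nat).
Implicit Types (S T U : {set 'I_n}) (x y z : clifford R n).

Local Notation blade := (@blade R n).
Local Notation sg := (@blade_sign R n).

Lemma scale_signE e x : (-1) ^+ e *: x = (-1) ^+ e * x.
Proof. by rewrite -signr_odd scaler_sign -mulr_sign signr_odd. Qed.

Lemma spin1 : spin (1 : clifford R n).
Proof. by exists [::]; split=> //; rewrite big_nil. Qed.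

Lemma spinM x y : spin x -> spin y -> spin (x * y).
Proof.
move=> [s [es us ->]] [t [et ut ->]]; exists (s ++ t); split.
- by rewrite size_cat oddD (negPf es) (negPf et).
- by move=> v; rewrite mem_cat => /orP[/us|/ut].
- by rewrite big_cat.
Qed.

Lemma spinX x e : spin x -> spin (x ^+ e).
Proof.
move=> sx; elim: e => [|e IHe]; first by rewrite expr0; apply: spin1.
by rewrite exprS; apply: spinM.
Qed.

Lemma delta_unit (i : 'I_n) :
  (delta_mx i 0 : 'cV[R]_n)^T *m delta_mx i 0 = 1%:M.
Proof.
rewrite trmx_delta mul_delta_mx; apply/matrixP => a b.
by rewrite !mxE !ord1.
Qed.

(** The index [i] ensures [n > 0], and then [-1 = e_i ^ 2]; for [n = 0] there are no unit vectors
    and [1] is the only spin element. *)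
Lemma spinN1 (i : 'I_n) : spin (-1 : clifford R n).
Proof.
exists [:: delta_mx i 0; delta_mx i 0]; split=> //.
  by move=> v; rewrite !inE orbb => /eqP->; apply: delta_unit.
by rewrite !big_cons big_nil mulr1 unit_vec_sqr // delta_unit.
Qed.

Lemma spin_blade S : ~~ odd #|S| -> spin (blade S).
Proof.
(* An element of [S] is needed for [spinN1], which absorbs the sign left open by [prod_blade1]. *)
move=> Sev; have [->|[i iS]] := set_0Vmem S; first exact: spin1.
have [e es] := prod_blade1 R (enum_uniq (mem S)).
rewrite -[blade S]scale1r -(sqrr_sign R e) expr2 -scalerA.
have <- : [set t in enum S] = S by apply/setP => t; rewrite inE mem_enum.
rewrite -es scale_signE; apply: spinM; first exact/spinX/(spinN1 i).
exists [seq delta_mx t 0 | t <- enum S]; split.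
- by rewrite size_map -cardE.
- by move=> v /mapP[t _ ->]; apply: delta_unit.
- by rewrite big_map; apply: eq_bigr => t _; rewrite cliff_vec_delta.
Qed.

Lemma spin_coverE x (M : 'M[R]_n) :
  (forall j, x * blade [set j] * cliff_conj x = cliff_vec (col j M)) ->
  spin_cover x = M.
Proof. by move=> xM; apply/matrixP => i j; rewrite mxE xM cliff_vecE mxE. Qed.

Lemma spin_coverM x y : spin x -> spin y ->
  spin_cover (x * y) = spin_cover x *m spin_cover y.
Proof.
move=> sx sy; apply: spin_coverE => j; rewrite cliff_conjM.
rewrite -!mulrA (mulrA _ _ (cliff_conj x)) (mulrA _ _ (cliff_conj x)).
by rewrite (mulrA y) -cliff_vec_delta spin_coverP // mulrA spin_coverP // colE mulmxA.
Qed.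

Lemma spin_cover_blade S : ~~ odd #|S| ->
  spin_cover (blade S) = diag_mx (\row_t (-1) ^+ (t \in S)).
Proof.
move=> Sev; apply: spin_coverE => j; rewrite blade_conj_vec exprD.
rewrite -[(-1) ^+ #|S|]signr_odd (negPf Sev) mul1r -cliff_vec_delta.
rewrite -linearZ; congr cliff_vec; apply/colP => i; rewrite !mxE !eqxx andbT.
by case: eqP => [->|_]; rewrite ?mulr1n ?mulr0n ?mulr1 ?mulr0.
Qed.

Lemma spin_cover1 : spin_cover (1 : clifford R n) = 1%:M.
Proof.
rewrite (_ : 1 = blade set0) // spin_cover_blade ?cards0 //.
rewrite -diag_const_mx; congr diag_mx.
by apply/rowP => t; rewrite !mxE inE.
Qed.

(** Induction on the last factor: in [cliff_conj x * x] the inner product cancels first and leaves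
    [- u ^ 2 = 1]. *)
Lemma spin_conjVl x : spin x -> cliff_conj x * x = 1.
Proof.
case=> s [_ us ->]; elim/last_ind: s us => [_|s u IHs us].
  rewrite big_nil mulr1; apply/ffunP => S; rewrite !ffunE.
  by case: eqP => [->|]; rewrite ?blade_sign0l ?mulr1 ?mulr0.
have u1 : u^T *m u = 1%:M by apply: us; rewrite mem_rcons mem_head.
rewrite -cats1 big_cat big_seq1 cliff_conjM -mulrA (mulrA _ _ (cliff_vec u)).
rewrite IHs ?mul1r => [|w ws].
  by rewrite cliff_conj_vec mulNr unit_vec_sqr // opprK.
by apply: us; rewrite mem_rcons inE ws orbT.
Qed.

Lemma odd_card_symdiff S T : odd #|symdiff S T| = odd #|S| (+) odd #|T|.
Proof.
rewrite cardsU (_ : _ :&: _ = set0) ?cards0 ?subn0.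
  rewrite -(cardsID T S) -[in RHS](cardsID S T) setIC !oddD.
  by case: (odd _); case: (odd _); case: (odd _).
by apply/setP => i; rewrite !inE; case: (i \in S); case: (i \in T).
Qed.

Lemma cliff_vec_coef (v : 'cV[R]_n) S : ~~ odd #|S| -> cliff_vec v S = 0.
Proof.
move=> Sev; rewrite sum_ffunE big1 // => i _; rewrite !ffunE.
by case: eqP => [e|]; rewrite ?scaler0 // e cards1 in Sev *.
Qed.

(** Each vector factor flips the parity of the degree, so the induction runs over lists of either
    parity. *)
Lemma spin_even x S : spin x -> odd #|S| -> x S = 0.
Proof.
case=> s [/negPf es _ ->] So.
suff even0 : forall U, odd #|U| != odd (size s) ->
    (\prod_(v <- s) cliff_vec v : clifford R n) U = 0.
  by apply: even0; rewrite es So.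
elim: s {es} => [|v s IHs] U /= Us.
  by rewrite big_nil ffunE; case: (U =P set0) Us => [->|//]; rewrite cards0.
rewrite big_cons ffunE big1 // => V _.
have [Vo|Ve] := boolP (odd #|V|); last by rewrite cliff_vec_coef // mulr0 mul0r.
rewrite IHs ?mulr0 // odd_card_symdiff Vo.
by move: Us; case: (odd _); case: (odd _).
Qed.

(* An even element commuting with every generator is a scalar: if [S] is even
   and contains [t], then [e_S] anticommutes with [e_t]. *)
Lemma spin_cover_kernel z : spin z -> spin_cover z = 1%:M -> z = 1 \/ z = -1.
Proof.
move=> sz z1.
have zC (t : 'I_n) : z * blade [set t] = blade [set t] * z.
  rewrite -[LHS]mulr1 -(spin_conjVl sz) mulrA -cliff_vec_delta.
  by rewrite spin_coverP // z1 mul1mx.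
have z0 S : S != set0 -> z S = 0.
  move=> /set0Pn[t tS]; have [So|Se] := boolP (odd #|S|); first exact: spin_even.
  have := mul_blade_coef z [set t] S.
  rewrite zC symdiffC blade_mul_coef => /(congr1 ( *%R (sg S [set t]))).
  rewrite !mulrA blade_sign_sqr mul1r blade_sign_swap cards1 muln1.
  move: tS; rewrite -sub1set => /setIidPr->; rewrite cards1 addn1 exprS.
  rewrite -signr_odd (negPf Se) mulr1 mulN1r => /eqP.
  by rewrite eq_sym -subr_eq0 opprK -mulr2n mulrn_eq0 /= => /eqP.
have zE : z = (z set0)%:A.
  apply/ffunP => S; rewrite !ffunE; have [->|S0] := eqVneq S set0.
    by rewrite /GRing.scale /= mulr1.
  by rewrite (z0 S) // /GRing.scale /= mulr0.
(* Conjugation fixes scalars, so [z * cliff_conj z = 1] becomes [z ^ 2 = 1]. *)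
have cz : cliff_conj z = z.
  apply/ffunP => S; rewrite ffunE; have [->|S0] := eqVneq S set0.
    by rewrite blade_sign0l mul1r.
  by rewrite z0 // mulr0.
have /eqP : z set0 ^+ 2 = 1.
  have : z * z = 1 by rewrite -{2}cz spin_conjV.
  rewrite {1 2}zE -scalerAl mul1r scalerA => /ffunP/(_ set0).
  by rewrite !ffunE eqxx /GRing.scale /= mulr1.
rewrite sqrf_eq1 => /orP[] /eqP z01; rewrite zE z01; first by left; rewrite scale1r.
by right; rewrite scaleN1r.
Qed.

(** The product [x * blade S] lies over the square of a diagonal sign matrix, that is over the
    identity, hence is [1] or [-1]; and [blade S] is its own inverse up to sign. *)
Lemma spin_lift_blade S x : ~~ odd #|S| -> spin x ->
  spin_cover x = spin_cover (blade S) -> exists e : nat, x = (-1) ^+ e *: blade S.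
Proof.
move=> Sev sx xS; have sS := spin_blade Sev.
have xE : x = sg S S *: ((x * blade S) * blade S).
  by rewrite -mulrA blade_sqr -scalerAr mulr1 scalerA blade_sign_sqr scale1r.
have : x * blade S = 1 \/ x * blade S = -1.
  apply: spin_cover_kernel; first exact: spinM.
  rewrite spin_coverM // xS spin_cover_blade // mulmx_diag -diag_const_mx.
  by congr diag_mx; apply/rowP => t; rewrite !mxE -expr2 sqrr_sign.
case=> xS1; rewrite xE xS1 ?mulN1r ?mul1r; first by eexists.
by rewrite scalerN -scaleN1r scalerA /blade_sign -exprS; eexists.
Qed.

End SpinGroup.

(** * Integer powers of elements whose fourth power is 1 *)

Section ExponentMod4.

Local Open Scope ring_scope.

Variable L : nzRingType.
Implicit Types (x : L) (p q : int).

(** Reducing the exponent modulo 4 gives a natural number, so negative powers of a blade make sense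
    without an inverse operation. *)
Definition expz4 x q : L := x ^+ `|(q %% 4)%Z|%N.

Lemma expz4D x p q : x ^+ 4 = 1 -> expz4 x (p + q) = expz4 x p * expz4 x q.
Proof.
move=> x4; rewrite /expz4 -exprD -[RHS](expr_mod _ x4); congr (_ ^+ _); lia.
Qed.

Lemma expz4N x q : x ^+ 2 = 1 -> expz4 x (- q) = expz4 x q.
Proof.
move=> x2; rewrite /expz4 -(expr_mod _ x2) -[RHS](expr_mod _ x2).
by congr (_ ^+ _); lia.
Qed.

Lemma expz4_comm x y p q : GRing.comm x y -> GRing.comm (expz4 x p) (expz4 y q).
Proof. by move=> xy; apply/commrX/commr_sym/commrX/commr_sym. Qed.

End ExponentMod4.

(** * Real Bott groups and the obstruction coming from [A i j] *)

Section BottGroup.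

Local Open Scope ring_scope.

Variables (R : realType) (n : nat) (A : 'M[bool]_n).
Hypothesis A_upper : strictly_upper_triangular A.

Definition row_set (r : 'I_n) : {set 'I_n} := [set s | A r s].

Local Notation rblade r := (blade R (row_set r)).

Lemma spin_cover_row_set r : ~~ odd #|row_set r| ->
  spin_cover (rblade r) = bott_lin R A r.
Proof.
move=> rev; rewrite spin_cover_blade //; congr diag_mx.
by apply/rowP => t; rewrite !mxE inE.
Qed.

Lemma col_entryE (v : 'cV[R]_n) r : v r 0 = ((delta_mx 0 r : 'rV_n) *m v) 0 0.
Proof. by rewrite -rowE mxE. Qed.

Lemma delta_bott_lin r s :
  delta_mx 0 s *m bott_lin R A r = (-1) ^+ A r s *: delta_mx 0 s :> 'rV_n.
Proof.
apply/rowP => t; rewrite -rowE !mxE eqxx (eq_sym t) /=.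
by case: eqP => [->|_]; rewrite ?mulr1n ?mulr0n ?mulr1 ?mulr0.
Qed.

Lemma bott_lin_delta r s :
  bott_lin R A r *m delta_mx s 0 = (-1) ^+ A r s *: delta_mx s 0 :> 'cV_n.
Proof.
apply/colP => t; rewrite -colE !mxE eqxx andbT.
by case: eqP => [->|_]; rewrite ?mulr1n ?mulr0n ?mulr1 ?mulr0.
Qed.

(** This is [s_i s_j s_i^-1 = s_j^-1] without inverses. The linear parts are commuting involutions;
    on translations, [s_i] negates coordinate [j], while [s_j] fixes coordinates [i] and [j]. *)
Lemma bott_gen_relation (i j : 'I_n) : (i < j)%N -> A i j ->
  (bott_gen R A j * (bott_gen R A i * bott_gen R A j))%g = bott_gen R A i.
Proof.
move=> ij Aij; apply: isometry_eq => /=.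
  rewrite /bott_lin !mulmx_diag; congr diag_mx; apply/rowP => t; rewrite !mxE.
  by rewrite mulrCA -expr2 sqrr_sign mulr1.
rewrite -scalemxAr bott_lin_delta Aij mulmxDr -!scalemxAr !bott_lin_delta.
rewrite (A_upper (leqnn j)) (A_upper (ltnW ij)) expr1 expr0 !scale1r scaleN1r.
by rewrite scalerN addrAC addNr add0r.
Qed.

(** Applying [eps] to [bott_gen_relation], the sign of the lift of [s_j] occurs twice and cancels;
    as the two blades commute, what remains is [e_{S_j}^2 e_{S_i} = e_{S_i}]. *)
Lemma spin_structure_row_sqr (i j : 'I_n) : (i < j)%N -> A i j ->
  ~~ odd #|row_set i| -> ~~ odd #|row_set j| ->
  ~~ odd #|row_set i :&: row_set j| ->
  has_spin_structure (bott_group R A) -> blade_sign R (row_set j) (row_set j) = 1.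
Proof.
move=> ij Aij iev jev ijev [eps [eps_spin epsM eps_cover]].
have gen r : bott_group R A (bott_gen R A r) by apply: generated_gen.
have lift r : ~~ odd #|row_set r| ->
    exists e : nat, eps (bott_gen R A r) = (-1) ^+ e *: rblade r.
  move=> rev; apply: spin_lift_blade => //; first exact: eps_spin.
  by rewrite eps_cover // spin_cover_row_set.
have := bott_gen_relation ij Aij => /(congr1 eps).
rewrite (epsM _ _ (gen j) (generated_mul (gen i) (gen j))) epsM //.
have [a ->] := lift i iev; have [b ->] := lift j jev.
rewrite -!scalerAl -!scalerAr !scalerA -[rblade i * rblade j]blade_mulC; last first.
  by rewrite setIC oddD oddM (negPf jev) (negPf ijev).
rewrite (mulrA (rblade j)) blade_sqr -scalerAl mul1r scalerA.
move=> /ffunP/(_ (row_set i)); rewrite !ffunE eqxx /GRing.scale /= !mulr1.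
move/(congr1 ( *%R ((-1) ^+ a))); rewrite -[RHS]expr2 sqrr_sign => <-.
have := sqrr_sign R a; have := sqrr_sign R b; rewrite !expr2.
move: ((-1) ^+ a) ((-1) ^+ b) (blade_sign _ _ _) => u v w vv uu.
transitivity ((u * u) * (v * v) * w); last by ring.
by rewrite uu vv !mul1r.
Qed.

(** * Construction of a Spin-structure for two non-zero rows *)

Section TwoRows.

Variables i j : 'I_n.
Hypothesis lt_ij : (i < j)%N.
Hypothesis rows : forall r s, A r s -> r = i \/ r = j.
Hypothesis even_i : ~~ odd #|row_set i|.
Hypothesis even_j : ~~ odd #|row_set j|.
Hypothesis even_ij : ~~ odd #|row_set i :&: row_set j|.
Hypothesis sqr_j : A i j -> blade_sign R (row_set j) (row_set j) = 1.

(** The intended value of the Spin-structure on an element whose translation has coordinates [p / 2]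
    at [i] and [q / 2] at [j]. *)
Definition row_lift (p q : int) : clifford R n :=
  expz4 (rblade i) p * expz4 (rblade j) q.

(* [p] and [q] are twice the coordinates [i] and [j] of the translation part,
   and [c] is the sign by which [g] acts on coordinate [j]. *)
Definition tracked (g : Defs.isometry R n) (p q c : int) : Prop :=
  [/\ delta_mx 0 i *m lin_part g = delta_mx 0 i :> 'rV_n,
      delta_mx 0 j *m lin_part g = c%:~R *: delta_mx 0 j :> 'rV_n,
      c = 1 \/ A i j /\ c = -1,
      trans_part g i 0 = p%:~R / 2 /\ trans_part g j 0 = q%:~R / 2
    & spin_cover (row_lift p q) = lin_part g].

Lemma spin_row_lift p q : spin (row_lift p q).
Proof. by apply: spinM; apply: spinX; apply: spin_blade. Qed.

(** The twist [c] is [-1] only if [A i j] holds; then [e_{S_j}] squares to 1 and its exponent may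
    change sign. The rest is commutation of the two blades. *)
Lemma row_liftD p q p' q' c : c = 1 \/ A i j /\ c = -1 ->
  row_lift (p + p') (q + c * q') = row_lift p q * row_lift p' q'.
Proof.
move=> c1; have -> : row_lift (p + p') (q + c * q') = row_lift (p + p') (q + q').
  case: c1 => [->|[Aij ->]]; first by rewrite mul1r.
  rewrite mulN1r /row_lift !expz4D ?blade_exp4 // [expz4 _ (- _)]expz4N //.
  by rewrite expr2 blade_sqr sqr_j // scale1r.
rewrite /row_lift !expz4D ?blade_exp4 // -!mulrA; congr (_ * _).
rewrite !mulrA; congr (_ * _); apply: expz4_comm; apply: blade_mulC.
by rewrite oddD oddM (negPf even_i) (negPf even_ij).
Qed.

Lemma row_lift0 : row_lift 0 0 = 1.
Proof. by rewrite /row_lift /expz4 mod0z !expr0 mulr1. Qed.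

Lemma tracked_mul g h p q c p' q' c' :
  tracked g p q c -> tracked h p' q' c' ->
  tracked (g * h)%g (p + p') (q + c * q') (c * c').
Proof.
move=> [gi gj c1 [gp gq] gl] [hi hj c1' [hp hq] hl]; split.
- by rewrite /= mulmxA gi.
- by rewrite /= mulmxA gj -scalemxAl hj scalerA intrM.
- by case: c1 c1' => [->|[Aij ->]] [->|[Aij' ->]]; [left|right|right|left].
- split; rewrite col_entryE /= mulmxDr mulmxA ?gi ?gj -?scalemxAl mxE.
    by rewrite -!col_entryE hp gp intrD mulrDl addrC.
  by rewrite mxE -!col_entryE hq gq intrD intrM mulrDl addrC mulrA.
- by rewrite row_liftD // spin_coverM ?gl ?hl //; apply: spin_row_lift.
Qed.

Lemma tracked_inv g p q c :
  tracked g p q c -> tracked g^-1%g (- p) (- (c * q)) c.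
Proof.
move=> [gi gj c1 [gp gq] gl]; have gO := eqP (isometry_orthogonal g).
have cc : c * c = 1 by case: c1 => [->|[_ ->]].
have gi' : delta_mx 0 i *m (lin_part g)^T = delta_mx 0 i :> 'rV_n.
  by rewrite -{1}gi -mulmxA gO mulmx1.
have gj' : delta_mx 0 j *m (lin_part g)^T = c%:~R *: delta_mx 0 j :> 'rV_n.
  have cc' : c%:~R * c%:~R = 1 :> R by rewrite -intrM cc.
  rewrite -[LHS]scale1r -[in LHS]cc' -scalerA scalemxAl -[in LHS]gj.
  by rewrite -mulmxA gO mulmx1.
split=> //.
- split; rewrite col_entryE /= mulmxN mulmxA ?gi' ?gj' -?scalemxAl mxE.
    by rewrite -col_entryE gp intrN mulNr.
  by rewrite mxE -col_entryE gq intrN intrM mulNr mulrA.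
(* As [c * c = 1], the two lifts multiply to [row_lift 0 0 = 1], so their covers are inverse
   matrices. *)
- have : spin_cover (row_lift p q) *m spin_cover (row_lift (- p) (- (c * q))) = 1%:M.
    rewrite -spin_coverM; try exact: spin_row_lift.
    by rewrite -(row_liftD _ _ _ _ c1) subrr mulrN mulrA cc mul1r subrr row_lift0 spin_cover1.
  rewrite gl => /(congr1 (mulmx (lin_part g)^T)).
  by rewrite mulmxA (mulmx1C gO) mul1mx mulmx1.
Qed.

Lemma tracked_gen r : exists p q c, tracked (bott_gen R A r) p q c.
Proof.
have ji : (j == i) = false by apply/negbTE; rewrite -val_eqE /= neq_ltn lt_ij orbT.
(* By strict upper triangularity, neither non-zero row meets column [i], and only row [i] can meet
   column [j]. *)
have Ari : A r i = false.
  by apply/negP => Ari; have := Ari; case: (rows Ari) => ->; rewrite A_upper // ltnW.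
have Arj : r != i -> A r j = false.
  by move=> ri; apply/negP => Arj; have := Arj; case: (rows Arj) ri => ->;
     rewrite ?eqxx // A_upper.
(* The translation is half a basis vector, so its doubled coordinates are Kronecker symbols. *)
exists (r == i)%:Z, (r == j)%:Z, ((-1) ^+ A r j); split.
- by rewrite delta_bott_lin Ari scale1r.
- by rewrite delta_bott_lin rmorphXn /= rmorphN1.
- have [->|/Arj->] := eqVneq r i; last by left.
  by case Aij: (A i j); [right|left].
- by rewrite !mxE eqxx andbT !(eq_sym r) -mulrzl; split; case: eqP => _; rewrite ?mulr1 ?mulr0 ?mul0r ?mul1r.
- rewrite /row_lift /expz4; have [->|ri] := eqVneq r i.
    by rewrite eq_sym ji expr1 mulr1 spin_cover_row_set.
  have [->|rj] := eqVneq r j.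
    by rewrite mul1r spin_cover_row_set.
  rewrite mulr1 spin_cover1 /bott_lin -diag_const_mx; congr diag_mx.
  apply/rowP => s; rewrite !mxE; case Ars: (A r s) => //.
  by case: (rows Ars) => e; rewrite e eqxx in ri rj.
Qed.

Lemma tracked_group g : bott_group R A g -> exists p q c, tracked g p q c.
Proof.
elim=> [r||g' h _ [p [q [c gt]]] _ [p' [q' [c' ht]]]|h _ [p [q [c ht]]]].
- exact: tracked_gen.
- exists 0, 0, 1; split=> //=; rewrite ?mulmx1 ?scale1r ?mxE ?mul0r //; first by left.
  by rewrite row_lift0 spin_cover1.
- by eexists; eexists; eexists; apply: tracked_mul gt ht.
- by eexists; eexists; eexists; apply: tracked_inv ht.
Qed.

(** The lift is read off the translation part alone. The floor makes it total on isometries, and is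
    exact on the group, where the doubled coordinates [i] and [j] are integers. *)
Lemma two_rows_spin_structure : has_spin_structure (bott_group R A).
Proof.
pose coord (g : Defs.isometry R n) r := Num.floor (2 * trans_part g r 0).
have coordE g p q c : tracked g p q c -> coord g i = p /\ coord g j = q.
  by case=> _ _ _ [gp gq] _; rewrite /coord gp gq !(mulrC 2) !divfK ?pnatr_eq0 // !intrKfloor.
exists (fun g => row_lift (coord g i) (coord g j)); split.
- by move=> g _; apply: spin_row_lift.
- move=> g h /tracked_group[p [q [c gt]]] /tracked_group[p' [q' [c' ht]]].
  have [-> ->] := coordE _ _ _ _ (tracked_mul gt ht).
  have [-> ->] := coordE _ _ _ _ gt; have [-> ->] := coordE _ _ _ _ ht.
  by apply: row_liftD; case: gt.
- move=> g /tracked_group[p [q [c gt]]]; have [-> ->] := coordE _ _ _ _ gt.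
  by case: gt.
Qed.

End TwoRows.

End BottGroup.

(** * Interval supports and the parity count *)

Lemma card_index_in n a b : (b <= n)%N ->
  #|[set r : 'I_n | index_in (a + 1) b r]| = (b - a)%N.
Proof.
move=> bn; rewrite -sum1_card.
(* Since [index_in] counts from 1, the bounds [a + 1] and [b] select [a <= r < b] for the 0-based
   [r]. *)
rewrite (eq_bigl (fun r : 'I_n => (r < b) && (a <= r))%N) => [|r]; last first.
  by rewrite inE /index_in addn1 andbC.
rewrite -(big_mkord (fun r => (r < b) && (a <= r))%N (fun=> 1%N)).
rewrite -[LHS](big_nat_widenl a 0 n (fun r => r < b)%N) // -[LHS](big_nat_widen a b n xpredT) //.
by rewrite sum_nat_const_nat muln1.
Qed.

Theorem theorem3p2 (R : realType) (n : nat) (A : 'M[bool]_n) (i j : 'I_n)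
    (k l m i1 : nat)
    (A_upper : strictly_upper_triangular A)
    (lt_ij : (i < j)%N)
    (A_rows : forall r : 'I_n, (exists s : 'I_n, A r s) <-> r = i \/ r = j)
    (A_orientable : flat_orientable (bott_group R A))
    (l_ge1 : (1 <= l)%N)
    (bound : (i1 + 2 * k + 2 * l + 2 * m <= n)%N) :
  ((forall r : 'I_n, A i r = index_in (i1 + 1) (i1 + 2 * k + 2 * l) r) ->
   (forall s : 'I_n,
      A j s = index_in (i1 + 2 * k + 1) (i1 + 2 * k + 2 * l + 2 * m) s) ->
   has_spin_structure (bott_group R A) <->
     (odd l = odd m \/
      odd l <> odd m /\ ~ index_in (i1 + 1) (i1 + 2 * k) j))
  /\
  ((forall r : 'I_n, A j r = index_in (i1 + 1) (i1 + 2 * k + 2 * l) r) ->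
   (forall s : 'I_n,
      A i s = index_in (i1 + 2 * k + 1) (i1 + 2 * k + 2 * l + 2 * m) s) ->
   has_spin_structure (bott_group R A)).
Proof.
(* The 0-based position of index [i1 + 2k + 1], where the support of row [j] starts in the first
   case; it is below [n] because [l >= 1]. *)
have o_lt : (i1 + 2 * k < n)%N by lia.
have rows r s : A r s -> r = i \/ r = j by move=> Ars; apply/A_rows; exists s.
(* The intersection runs from the later start to the earlier end; in both cases it has [2l]
   elements. *)
have inter (r s : 'I_n) a b c d : (a <= c)%N -> (b <= d)%N ->
    (forall t : 'I_n, A r t = index_in (a + 1) b t) ->
    (forall t : 'I_n, A s t = index_in (c + 1) d t) ->
    row_set A r :&: row_set A s = [set t : 'I_n | index_in (c + 1) b t].
  move=> ac bd rE sE; apply/setP => t; rewrite !inE rE sE /index_in; lia.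
have card r a b : (b <= n)%N ->
    (forall t : 'I_n, A r t = index_in (a + 1) b t) -> #|row_set A r| = (b - a)%N.
  move=> bn rE; rewrite -(card_index_in a bn); congr #|pred_of_set _|.
  by apply/setP => t; rewrite !inE rE.
have bound' : (i1 + 2 * k + 2 * l <= n)%N by lia.
split=> [iE jE|jE iE].
- have ci := card _ _ _ bound' iE; have cj := card _ _ _ bound jE.
  have cij := inter _ _ _ _ _ _ (leq_addr _ _) (leq_addr _ _) iE jE.
  have iev : ~~ odd #|row_set A i| by rewrite ci; lia.
  have jev : ~~ odd #|row_set A j| by rewrite cj; lia.
  have ijev : ~~ odd #|row_set A i :&: row_set A j|.
    by rewrite cij card_index_in //; lia.
  have sgj : blade_sign R (row_set A j) (row_set A j) = ((-1) ^+ (l + m))%R.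
    by apply: blade_sign_diag; rewrite cj; lia.
  split=> [spinA|lm].
    (* If the parities differ and [j] lies in the interval, then [A i j] holds and the square of the
       blade of row [j] would be both [1] and [-1]. *)
    have [|/eqP lm] := eqVneq (odd l) (odd m); [by left|right; split=> // ij].
    have Aij : A i j by rewrite iE; move: ij; rewrite /index_in; lia.
    have := spin_structure_row_sqr A_upper lt_ij Aij iev jev ijev spinA.
    rewrite sgj -signr_odd oddD; have -> : odd l (+) odd m by lia.
    by move/eqP; rewrite eq_sym -subr_eq0 opprK -mulr2n pnatr_eq0.
  apply: (two_rows_spin_structure A_upper lt_ij rows) => // Aij.
  rewrite sgj -signr_odd oddD; have Ajo : A j (Ordinal o_lt).
    by rewrite jE /index_in /=; lia.
  (* A non-zero entry of row [j] lies strictly to the right of column [j]. *)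
  have jo : (j < i1 + 2 * k)%N.
    by rewrite ltnNge; apply/negP => oj; rewrite A_upper in Ajo.
  (* With [A i j], the index [j] is also at least [i1 + 1], hence in the excluded interval, and only
     equal parity is left. *)
  have -> : odd l (+) odd m = false.
    case: lm => [->|[_ []]]; first by rewrite addbb.
    by move: Aij; rewrite iE /index_in; lia.
  by [].
- have ci := card _ _ _ bound iE; have cj := card _ _ _ bound' jE.
  have cij := inter _ _ _ _ _ _ (leq_addr _ _) (leq_addr _ _) jE iE.
  apply: (two_rows_spin_structure A_upper lt_ij rows); rewrite ?ci ?cj; try lia.
    by rewrite setIC cij card_index_in //; lia.
  (* Row [j] now starts at index [i1 + 1], so the index [j] is at most [i1], left of the support of
     row [i]: the condition on the square holds vacuously. *)
  have o'_lt : (i1 < n)%N by lia.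
  have Ajo : A j (Ordinal o'_lt) by rewrite jE /index_in /=; lia.
  have jo : (j < i1)%N.
    by rewrite ltnNge; apply/negP => oj; rewrite A_upper in Ajo.
  by rewrite iE /index_in; lia.
Qed.
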